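(* Let $\alpha\ge1$, $n=\sum_{i=1}^\alpha n_i$, $\mathbb{R}^n=\prod_{i=1}^\alpha\mathbb{R}^{n_i}$, let $a>0$, let $C$ be a nonempty closed convex set in $\mathbb{R}^n$, and let $A$ be a multivalued maximal $a$-strongly monotone operator in $\mathbb{R}^n$ such that $D(A)=C$. Then: 1. The variational inequality problem $$\text{find } x^*\in C \text{ such that } \exists\, y^*\in Ax^*,\ \langle y^*,x-x^*\rangle\ge0\ \ \forall x\in C$$ has a unique solution $x^*$. 2. Let $T$ be the multifunction on $\mathbb{R}^n$ defined by $Tx=Ax+N_C(x)$ if $x\in C$ and $Tx=\emptyset$ if $x\notin C$. Let $c>0$ satisfy $c\ge\frac{\sqrt\alpha-1}{a}$, and let $F=(I+cT)^{-1}$ (a single-valued mapping). Then any parallel asynchronous algorithm with bounded delays associated with $F$ converges, from any initial point $x^0\in\mathbb{R}^n$, to the unique solution $x^*$ of the variational inequality problem: find $x^*\in C$ such that $\exists\, y^*\in Ax^*$, $\langle y^*,x-x^*\rangle\ge0$ $\forall x\in C$.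
   Context: Vectors of $\mathbb{R}^n=\prod_{i=1}^{\alpha}\mathbb{R}^{n_i}$ are written $x=(x_1,\dots,x_\alpha)$, $x_i\in\mathbb{R}^{n_i}$; $\langle\cdot,\cdot\rangle$ and $\|\cdot\|$ are the Euclidean inner product and norm on $\mathbb{R}^n$. A multifunction $A$ from $D(A)\subseteq\mathbb{R}^n$ to $\mathbb{R}^n$ is monotone if $\langle x-x',y-y'\rangle\ge0$ for all $x,x'\in D(A)$, $y\in Ax$, $y'\in Ax'$; it is maximal monotone if moreover its graph is not properly contained in the graph of another monotone operator; it is $a$-strongly monotone if $\langle x-x',y-y'\rangle\ge a\|x-x'\|^2$ for all $x,x'\in D(A)$, $y\in Ax$, $y'\in Ax'$. ''Maximal $a$-strongly monotone'' means maximal monotone and $a$-strongly monotone. $D(A)$ is the set of $x$ with $Ax\neq\emptyset$. The normal cone to $C$ at $x$ is $N_C(x)=\{y\in\mathbb{R}^n:\langle y,x-z\rangle\ge0\ \forall z\in C\}$. Parallel asynchronous algorithm with bounded delays associated with $F=(F_1,\dots,F_\alpha):\mathbb{R}^n\to\mathbb{R}^n$: given $x^0\in\mathbb{R}^n$, a sequence $\{J(p)\}_{p\in\mathbb{N}}$ of nonempty subsets of $\{1,\dots,\alpha\}$ and a sequence $\{(s_1(p),\dots,s_\alpha(p))\}_{p\in\mathbb{N}}$ in $\mathbb{N}^\alpha$, it generates for $p=0,1,\dots$ and $i=1,\dots,\alpha$: $x_i^{p+1}=x_i^p$ if $i\notin J(p)$, and $x_i^{p+1}=F_i(x_1^{s_1(p)},\dots,x_\alpha^{s_\alpha(p)})$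 if $i\in J(p)$; where it is assumed that (bounded delays) there is $s\in\mathbb{N}$ with $p-s\le s_i(p)\le p$ for all $i$ and $p$, and (synchronization) there is a strictly increasing sequence $\{p_k\}_{k\in\mathbb{N}}$ in $\mathbb{N}$ such that for all $k$ and all $i\in\{1,\dots,\alpha\}$, $i\in J(p_k)$ and $s_i(p_k)=p_k$. *)

(* Defs.v *)
From HB Require Import structures.
From mathcomp Require Export all_boot all_order all_algebra.
From mathcomp Require Export all_classical all_reals all_analysis.

Set Implicit Arguments.
Unset Strict Implicit.
Unset Printing Implicit Defensive.

Import Order.TTheory GRing.Theory Num.Theory.
Import numFieldNormedType.Exports.

Local Open Scope classical_set_scope.
Local Open Scope ring_scope.

Section Euclidean.
Variables (R : realType) (n : nat).

(* The library's norm `|x| on 'rV[R]_n is the sup norm; it is used only through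
   the topology it induces, which is the Euclidean one. *)
Definition dotp (x y : 'rV[R]_n) : R := \sum_i x ord0 i * y ord0 i.

Definition enorm (x : 'rV[R]_n) : R := Num.sqrt (dotp x x).

End Euclidean.

Section Operators.
Variables (R : realType) (n : nat).
Implicit Types (A T : 'rV[R]_n -> set 'rV[R]_n) (C : set 'rV[R]_n).

Definition op_dom A : set 'rV[R]_n := [set x | A x !=set0].

Definition op_graph A : set ('rV[R]_n * 'rV[R]_n) := [set p | A p.1 p.2].

Definition op_inv A : 'rV[R]_n -> set 'rV[R]_n := fun x => [set y | A y x].

Definition monotone_op A :=
  forall x x' y y', A x y -> A x' y' -> 0 <= dotp (x - x') (y - y').

Definition maximal_monotone A :=
  monotone_op A /\ ~ exists2 B, monotone_op B & op_graph A `<` op_graph B.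

Definition strongly_monotone (a : R) A :=
  forall x x' y y', A x y -> A x' y' ->
    a * enorm (x - x') ^+ 2 <= dotp (x - x') (y - y').

Definition maximal_strongly_monotone (a : R) A :=
  maximal_monotone A /\ strongly_monotone a A.

Definition normal_cone C (x : 'rV[R]_n) : set 'rV[R]_n :=
  [set y | forall z, C z -> 0 <= dotp y (x - z)].

Definition vi_solution A C (x : 'rV[R]_n) :=
  C x /\ exists2 y, A x y & forall z, C z -> 0 <= dotp y (z - x).

Definition vi_op A C : 'rV[R]_n -> set 'rV[R]_n := fun x =>
  if x \in C then [set u + v | u in A x & v in normal_cone C x] else set0.

Definition id_plus (c : R) T : 'rV[R]_n -> set 'rV[R]_n := fun x =>
  [set x + c *: t | t in T x].

Definition resolvent (c : R) T := op_inv (id_plus c T).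

End Operators.

Section Asynchronous.
Variables (R : realType) (alpha : nat) (n_ : 'I_alpha -> nat).

Definition bounded_delays (s : nat -> 'I_alpha -> nat) :=
  exists d : nat, forall p i, (p - d <= s p i <= p)%N.

Definition synchronized (J : nat -> set 'I_alpha)
    (s : nat -> 'I_alpha -> nat) :=
  exists2 pk : nat -> nat, {homo pk : k l / (k < l)%N} &
    forall k i, J (pk k) i /\ s (pk k) i = pk k.

(* R^n is the product of the R^(n_ i): the i-th block of x is submxrow x i,
   and \mxrow_j u j has the vectors u j as its blocks. *)
Definition async_iterates
    (F : 'rV[R]_(\sum_i n_ i) -> 'rV[R]_(\sum_i n_ i))
    (x0 : 'rV[R]_(\sum_i n_ i)) (J : nat -> set 'I_alpha)
    (s : nat -> 'I_alpha -> nat) (x : nat -> 'rV[R]_(\sum_i n_ i)) :=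
  x 0%N = x0 /\
  forall p i,
    (~ J p i -> submxrow (x p.+1) i = submxrow (x p) i) /\
    (J p i -> submxrow (x p.+1) i =
              submxrow (F (\mxrow_j submxrow (x (s p j)) j)) i).

Definition async_algorithm
    (F : 'rV[R]_(\sum_i n_ i) -> 'rV[R]_(\sum_i n_ i))
    (x0 : 'rV[R]_(\sum_i n_ i)) (J : nat -> set 'I_alpha)
    (s : nat -> 'I_alpha -> nat) (x : nat -> 'rV[R]_(\sum_i n_ i)) :=
  [/\ forall p, J p !=set0, bounded_delays s, synchronized J s
    & async_iterates F x0 J s x].

End Asynchronous.

(* Main.v *)
Require Import Defs.
From mathcomp Require Import zify ring lra.
Import Order.TTheory GRing.Theory Num.Theory.
Import numFieldNormedType.Exports.
Local Open Scope classical_set_scope.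
Local Open Scope ring_scope.

(** The operator T = A + N_C is A itself: its graph contains that of A, because
    0 is normal to C at every point of C, and it is monotone with respect to A,
    so the maximality of A leaves no room for anything else ([vi_op_dom]).  For
    the same reason the solutions of the variational inequality are the zeros
    of A ([vi_solutionE]), and F is the resolvent of A.

    Existence, both of a zero and of the values of the resolvent, is Minty's
    surjectivity theorem.  It rests on the Debrunner-Flor theorem
    ([debrunner_flor]): for a nonempty monotone set of pairs (u, v) there is an
    x with <u - x, v + x> >= 0 for all these pairs.  Lift each pair to the
    triple (u, v, <u, v>) and minimise the quadratic |u - v|^2 / 4 + r over the
    convex hull of the triples.  The form |u - v|^2 is strictly convex in
    w = u - v, so along a minimising sequence w converges, and half of its limit
    is the wanted x: the first-order optimality condition towards the triple of
    (u, v) bounds -<u - x, v + x> by the opposite of the infimum, and the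
    infimum is nonnegative because monotonicity extends to the hull in the form
    r >= <u, v>.

    For the convergence put b = 1 + c a, so that b > 1 and b >= sqrt alpha.
    With xstar the zero of A, f = F z - xstar and y = z - xstar, strong
    monotonicity gives b |f|^2 <= <f, y>.  The Lipschitz estimate |f| <= |y| / b
    that follows only makes F nonexpansive for the maximum of the block norms
    when b = sqrt alpha, but the inequality says more: f lies in the ball having
    the segment [0, y / b] as a diameter.  Hence
    |f_i| <= (|y_i| + |y|) / (2 b) <= (1 + sqrt alpha) / (2 b) max_j |y_j|, and
    this factor is less than 1 ([block_contraction],
    [contraction_factor_lt1]).  A contraction for the maximum of the block norms
    drives every asynchronous iteration with bounded delays to its fixed point
    ([async_cvg]): once all blocks stay within r, all reads do so after one
    delay, every later update lands within k r, and a synchronous step updates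
    all blocks. *)

(** * Euclidean inner product *)

Section InnerProduct.
Set Implicit Arguments.
Unset Strict Implicit.
Context {R : realType} {n : nat}.
Implicit Types (x y z : 'rV[R]_n) (c : R).

Lemma dotp_mulmx x y : dotp x y = (x *m y^T) ord0 ord0.
Proof. by rewrite mxE; apply: eq_bigr => i _; rewrite mxE. Qed.

Lemma dotpC x y : dotp x y = dotp y x.
Proof. by apply: eq_bigr => i _; rewrite mulrC. Qed.

Lemma dotpDl x y z : dotp (x + y) z = dotp x z + dotp y z.
Proof. by rewrite !dotp_mulmx mulmxDl mxE. Qed.

Lemma dotpDr x y z : dotp z (x + y) = dotp z x + dotp z y.
Proof. by rewrite dotpC dotpDl !(dotpC z). Qed.

Lemma dotpZl c x y : dotp (c *: x) y = c * dotp x y.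
Proof. by rewrite !dotp_mulmx -scalemxAl mxE. Qed.

Lemma dotpZr c x y : dotp x (c *: y) = c * dotp x y.
Proof. by rewrite dotpC dotpZl dotpC. Qed.

Lemma dotpNl x y : dotp (- x) y = - dotp x y.
Proof. by rewrite -scaleN1r dotpZl mulN1r. Qed.

Lemma dotpNr x y : dotp x (- y) = - dotp x y.
Proof. by rewrite dotpC dotpNl dotpC. Qed.

Lemma dotp0 x : dotp x 0 = 0.
Proof. by rewrite -(scale0r 0) dotpZr mul0r. Qed.

Definition dotpE := (dotpDl, dotpDr, dotpNl, dotpNr, dotpZl, dotpZr).

Lemma dotp_ge0 x : 0 <= dotp x x.
Proof. by apply: sumr_ge0 => i _; rewrite -expr2 sqr_ge0. Qed.

Lemma dotp_eq0 x : dotp x x = 0 -> x = 0.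
Proof.
move=> /eqP; rewrite psumr_eq0 => [/allP h|i _]; last by rewrite -expr2 sqr_ge0.
apply/rowP => i; have := h i; rewrite mem_index_enum mulf_eq0 orbb mxE.
by move=> /(_ isT)/eqP.
Qed.

Lemma enorm_ge0 x : 0 <= enorm x.
Proof. exact: sqrtr_ge0. Qed.

Lemma enorm_sqr x : enorm x ^+ 2 = dotp x x.
Proof. by rewrite sqr_sqrtr// dotp_ge0. Qed.

Lemma enormZ c x : 0 <= c -> enorm (c *: x) = c * enorm x.
Proof.
move=> c0; rewrite /enorm dotpZl dotpZr mulrA -expr2 sqrtrM ?sqr_ge0//.
by rewrite sqrtr_sqr ger0_norm.
Qed.

Lemma dotp_le_enorm x y : dotp x y <= enorm x * enorm y.
Proof.
have := dotp_ge0 (enorm y *: x - enorm x *: y).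
rewrite !dotpE (dotpC y x) -!enorm_sqr => h.
have [x0 y0] := (enorm_ge0 x, enorm_ge0 y).
have [xy0|] := ltP 0 (enorm x * enorm y).
  rewrite -(ler_pM2l xy0); lra.
move=> xy_le0; have /eqP : enorm x * enorm y = 0.
  by apply/eqP; rewrite eq_le xy_le0 mulr_ge0.
rewrite mulf_eq0 => /orP[] /eqP e0.
  have -> : x = 0 by apply: dotp_eq0; rewrite -enorm_sqr e0 expr0n.
  by rewrite dotpC dotp0 mulr_ge0// enorm_ge0.
have -> : y = 0 by apply: dotp_eq0; rewrite -enorm_sqr e0 expr0n.
by rewrite dotp0 mulr_ge0// enorm_ge0.
Qed.

Lemma enormD x y : enorm (x + y) <= enorm x + enorm y.
Proof.
rewrite -(ler_pXn2r (ltn0Sn 1)) ?nnegrE ?addr_ge0 ?enorm_ge0//.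
have := dotp_le_enorm x y.
rewrite enorm_sqr !dotpE (dotpC y x) sqrrD -!enorm_sqr; lra.
Qed.

(** Links the topology of row vectors, given by the sup norm, to Euclidean
    estimates. *)
Lemma norm_le_enorm x : `|x| <= enorm x.
Proof.
rewrite [`|x|]mx_normrE; apply: bigmax_le => [|[i j] _]; first exact: enorm_ge0.
rewrite -(ler_pXn2r (ltn0Sn 1)) ?nnegrE ?enorm_ge0// enorm_sqr (ord1 i) /=.
rewrite real_normK ?num_real// /dotp (bigD1 j)//= expr2 lerDl.
by apply: sumr_ge0 => k _; rewrite -expr2 sqr_ge0.
Qed.

Lemma cvg_dotp (f g : nat -> 'rV[R]_n) x y :
  f @ \oo --> x -> g @ \oo --> y ->
  (fun k => dotp (f k) (g k)) @ \oo --> dotp x y.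
Proof.
move=> fx gy; rewrite /dotp.
apply: cvg_big => [|i _]; first exact: add_continuous.
have fi : f k ord0 i @[k --> \oo] --> x ord0 i.
  exact: (cvg_comp _ _ fx (@coord_continuous _ _ _ ord0 i x)).
have gi : g k ord0 i @[k --> \oo] --> y ord0 i.
  exact: (cvg_comp _ _ gy (@coord_continuous _ _ _ ord0 i y)).
exact: cvgM.
Qed.

End InnerProduct.

(** * The Debrunner-Flor theorem *)

Section DebrunnerFlor.
Set Implicit Arguments.
Unset Strict Implicit.
Context {R : realType} {n : nat}.
Implicit Types (G : 'rV[R]_n -> set 'rV[R]_n) (u v : 'rV[R]_n) (r t d m : R).

(** The convex hull of the triples (u, v, <u, v>), with (u, v) in the graph of
    G.  Closure under segments replaces finite convex combinations, so that
    properties affine in each triple follow by induction. *)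
Inductive lifted_hull G : 'rV[R]_n -> 'rV[R]_n -> R -> Prop :=
| lifted_hull_gen u v : G u v -> lifted_hull G u v (dotp u v)
| lifted_hull_conv t u v r u' v' r' : 0 <= t -> t <= 1 ->
    lifted_hull G u v r -> lifted_hull G u' v' r' ->
    lifted_hull G (u + t *: (u' - u)) (v + t *: (v' - v)) (r + t * (r' - r)).

(** On generators this is the monotonicity inequality <u - u', v - v'> >= 0
    expanded; both sides are affine in each of the two triples, so it passes to
    the hull one argument at a time. *)
Lemma lifted_hull_monotone G : monotone_op G ->
  forall u v r u' v' r', lifted_hull G u v r -> lifted_hull G u' v' r' ->
  dotp u v' + dotp u' v <= r + r'.
Proof.
move=> Gmon u v r u' v' r' h; move: u' v' r'.
elim: h => {u v r} [u v Guv|t u v r u1 v1 r1 t0 t1 _ IH _ IH1] u' v' r' h'.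
  elim: h' => {u' v' r'} [u' v' Gu'v'|t u' v' r' u1 v1 r1 t0 t1 _ IH _ IH1].
    by have := Gmon _ _ _ _ Guv Gu'v'; rewrite !dotpE; lra.
  rewrite !dotpE.
  have := ler_wpM2l t0 IH1; have : (1 - t) * (dotp u v' + dotp u' v)
    <= (1 - t) * (dotp u v + r') by rewrite ler_wpM2l// subr_ge0.
  lra.
have := ler_wpM2l t0 (IH1 _ _ _ h').
have : (1 - t) * (dotp u v' + dotp u' v)
    <= (1 - t) * (r + r') by rewrite ler_wpM2l ?subr_ge0// IH.
by rewrite !dotpE; lra.
Qed.

(** The opposite of the minimum over x of <x - u, x + v>, where <u, v> is
    replaced by the third component r; that minimum is reached at
    x = (u - v) / 2. *)
Definition energy u v r := dotp (u - v) (u - v) / 4 + r.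

(** On the diagonal, [lifted_hull_monotone] reads <u, v> <= r, whence the energy
    is at least |u + v|^2 / 4. *)
Lemma energy_ge0 G u v r : monotone_op G -> lifted_hull G u v r ->
  0 <= energy u v r.
Proof.
move=> Gmon h; have := lifted_hull_monotone Gmon h h.
have := dotp_ge0 (u + v); rewrite /energy !dotpE (dotpC v u); lra.
Qed.

(** Approximate first-order optimality at (u, v, r): moving by d towards a
    generator (u', v', <u', v'>) cannot lower the energy by more than d^2.  With
    x = (u - v) / 2, the slope of the energy in that direction is
    -<x - u', x + v'> minus the energy, which is nonnegative.  Taking the step
    equal to the square root of the tolerance makes the bound vanish with d. *)
Lemma near_minimizer_defect G m d u v r u' v' : monotone_op G ->
  (forall u v r, lifted_hull G u v r -> m <= energy u v r) ->
  0 < d -> d <= 1 -> lifted_hull G u v r -> energy u v r <= m + d ^+ 2 ->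
  G u' v' ->
  dotp (2^-1 *: (u - v) - u') (2^-1 *: (u - v) + v') <=
  d * (1 + dotp (u' - v' - (u - v)) (u' - v' - (u - v)) / 4).
Proof.
move=> Gmon lbm d0 d1 h Qle Guv'.
have h' := lifted_hull_gen Guv'.
have := lbm _ _ _ (lifted_hull_conv (ltW d0) d1 h h').
have := energy_ge0 Gmon h.
move: Qle; rewrite /energy.
have -> : u + d *: (u' - u) - (v + d *: (v' - v)) =
          (u - v) + d *: (u' - v' - (u - v)).
  by apply/rowP => i; rewrite !mxE; ring.
(* Make the quantity to be bounded appear in the energy of the generator. *)
have -> : dotp u' v' = dotp (2^-1 *: (u - v)) (2^-1 *: (u - v))
   + dotp (2^-1 *: (u - v)) (v' - u')
   - dotp (2^-1 *: (u - v) - u') (2^-1 *: (u - v) + v').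
  by rewrite !dotpE (dotpC u' u) (dotpC u' v); field.
set phi := dotp (_ - u') _.
set w := u - v.
have -> : v' - u' = - (u' - v' - w) - w.
  by apply/rowP => i; rewrite !mxE; ring.
set e := u' - v' - w.
clearbody phi e w; rewrite !dotpE (dotpC e w) => Qle Q0 mle.
rewrite -(ler_pM2l d0).
have dQ : 0 <= d * (dotp w w / 4 + r) by rewrite mulr_ge0// ltW.
move: (dotp w w) (dotp w e) (dotp e e) Qle Q0 mle dQ => a b c *.
lra.
Qed.

(** Compare the energy at the midpoint with its lower bound m: this is what
    makes minimising sequences Cauchy. *)
Lemma energy_parallelogram G m u v r u' v' r' :
  (forall u v r, lifted_hull G u v r -> m <= energy u v r) ->
  lifted_hull G u v r -> lifted_hull G u' v' r' ->
  dotp (u' - v' - (u - v)) (u' - v' - (u - v)) <=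
  8 * ((energy u v r - m) + (energy u' v' r' - m)).
Proof.
move=> lbm h h'.
have h0 : 0 <= 2^-1 :> R by rewrite invr_ge0.
have h1 : 2^-1 <= 1 :> R by rewrite invf_le1// ler1n.
have := lbm _ _ _ (lifted_hull_conv h0 h1 h h').
rewrite /energy.
have -> : u + 2^-1 *: (u' - u) - (v + 2^-1 *: (v' - v)) =
          (u - v) + 2^-1 *: (u' - v' - (u - v)).
  by apply/rowP => i; rewrite !mxE; ring.
have -> : dotp (u' - v') (u' - v') =
  dotp ((u' - v' - (u - v)) + (u - v)) ((u' - v' - (u - v)) + (u - v)).
  by rewrite subrK.
set w := u - v; set e := u' - v' - w; clearbody e w.
rewrite !dotpE (dotpC e w); lra.
Qed.

Lemma cauchy_enorm_cvg (w : nat -> 'rV[R]_n) :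
  (forall eps : R, 0 < eps -> exists N, forall k l, (N <= k)%N -> (N <= l)%N ->
     enorm (w k - w l) <= eps) ->
  cvgn w.
Proof.
move=> wC; apply/cauchy_cvgP/cauchy_exP => eps eps0.
have [|N wN] := wC (eps / 2); first by lra.
exists (w N); exists N => // k /= Nk.
rewrite mx_norm_ball /ball_ /=.
apply: (le_lt_trans (norm_le_enorm _)); apply: (le_lt_trans (wN _ _ _ _)) => //.
lra.
Qed.

(** The point is half the limit of w = u - v along a minimising sequence of the
    energy on the hull; passing to the limit in [near_minimizer_defect] gives
    the inequality. *)
Lemma debrunner_flor G u0 v0 : monotone_op G -> G u0 v0 ->
  exists x, forall u v, G u v -> 0 <= dotp (u - x) (v + x).
Proof.
move=> Gmon G0.
pose E := [set e : R | exists u v r, lifted_hull G u v r /\ e = energy u v r].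
have Elb : has_lbound E.
  by exists 0 => _ [u [v [r [h ->]]]]; exact: energy_ge0 h.
have Einf : has_inf E.
  split=> //; exists (energy u0 v0 (dotp u0 v0)), u0, v0, (dotp u0 v0).
  by split=> //; exact: lifted_hull_gen.
pose m := inf E.
have lbm u v r : lifted_hull G u v r -> m <= energy u v r.
  by move=> h; apply: ge_inf => //; exists u, v, r.
have /choice[p pP] : forall k, exists p : 'rV[R]_n * 'rV[R]_n * R,
    lifted_hull G p.1.1 p.1.2 p.2 /\
    energy p.1.1 p.1.2 p.2 <= m + harmonic k ^+ 2.
  move=> k; have h2 : 0 < harmonic k ^+ 2 :> R.
    by rewrite exprn_gt0// harmonic_gt0.
  have [_ [u [v [r [h ->]]]] /ltW le] := inf_adherent h2 Einf.
  by exists (u, v, r).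
pose w k := (p k).1.1 - (p k).1.2.
have /cvg_ex[w0 ww0] : cvgn w.
  apply: cauchy_enorm_cvg => eps eps0.
  have /cvgrPdist_le/(_ (eps / 4)) := @cvg_harmonic R.
  case=> [|N _ Nh]; first by lra.
  exists N => k l Nk Nl.
  rewrite -(ler_pXn2r (ltn0Sn 1)) ?nnegrE ?enorm_ge0 ?(ltW eps0)// enorm_sqr.
  have [[hk Qk] [hl Ql]] := (pP k, pP l).
  (* 8 (h_k^2 + h_l^2) <= 16 (eps / 4)^2 = eps^2. *)
  apply: (le_trans (energy_parallelogram lbm hl hk)).
  have sq j : (N <= j)%N -> harmonic j ^+ 2 <= (eps / 4) ^+ 2 :> R.
    move=> /Nh; rewrite /= sub0r normrN ger0_norm ?harmonic_ge0// => le.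
    by rewrite ler_pXn2r// nnegrE ?harmonic_ge0//; lra.
  have := sq _ Nk; have := sq _ Nl; lra.
exists (2^-1 *: w0) => u v Guv.
have wcst (y : 'rV[R]_n) : (fun _ : nat => y) @ \oo --> y by exact: cvg_cst.
have xx0 : (fun k => 2^-1 *: w k) @ \oo --> 2^-1 *: w0.
  by apply: cvgZr.
have xu : (fun k => 2^-1 *: w k - u) @ \oo --> 2^-1 *: w0 - u by exact: cvgB.
have xv : (fun k => 2^-1 *: w k + v) @ \oo --> 2^-1 *: w0 + v by exact: cvgD.
have dw : (fun k => u - v - w k) @ \oo --> u - v - w0 by exact: cvgB.
have bound : harmonic k * (1 + dotp (u - v - w k) (u - v - w k) / 4)
    @[k --> \oo] --> 0 * (1 + dotp (u - v - w0) (u - v - w0) / 4).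
  apply: cvgM; first exact: cvg_harmonic.
  apply: cvgD; first exact: cvg_cst.
  by apply: cvgM; [exact: (cvg_dotp dw dw)|exact: cvg_cst].
have le : \forall k \near \oo, dotp (2^-1 *: w k - u) (2^-1 *: w k + v) <=
    harmonic k * (1 + dotp (u - v - w k) (u - v - w k) / 4).
  near=> k; have [h Q] := pP k.
  apply: (near_minimizer_defect Gmon lbm _ _ h Q Guv).
    exact: harmonic_gt0.
  by rewrite /harmonic /= invf_le1// ler1n.
have := ler_cvg_to (Fa := eventually_filter) (cvg_dotp xu xv) bound le.
rewrite mul0r -[in X in _ -> X](opprK (u - _)) dotpNl opprB (addrC v).
by rewrite oppr_ge0.
Unshelve. all: by end_near.
Qed.

End DebrunnerFlor.

(** * Maximal and strongly monotone operators *)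

Section MaximalMonotone.
Set Implicit Arguments.
Unset Strict Implicit.
Context {R : realType} {n : nat}.
Variable A : 'rV[R]_n -> set 'rV[R]_n.
Hypothesis Amax : maximal_monotone A.

(** The form in which maximality is used: otherwise adding the pair (x, y)
    would properly extend the graph. *)
Lemma maximal_monotone_mem x y :
  (forall u v, A u v -> 0 <= dotp (x - u) (y - v)) -> A x y.
Proof.
have [Amon Anomax] := Amax => xy; apply: contrapT => nAxy; apply: Anomax.
exists (fun u v => A u v \/ (u = x /\ v = y)).
  move=> u u' v v' [Auv|[-> ->]] [Auv'|[-> ->]].
  - exact: Amon.
  - by rewrite -(opprB x) -(opprB y) dotpNl dotpNr opprK xy.
  - exact: xy.
  - by rewrite !subrr dotp0.
split=> [[u v] /= Auv|/(_ (x, y))]; first by left.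
by move=> /(_ (or_intror (conj erefl erefl))).
Qed.

(** Debrunner-Flor for the monotone set of pairs (u, c v - z) gives an x such
    that (x, (z - x) / c) is monotonically related to the graph of A. *)
Lemma minty (c : R) (z u0 v0 : 'rV[R]_n) : 0 < c -> A u0 v0 ->
  exists x, A x (c^-1 *: (z - x)).
Proof.
move=> c0 Auv0; have [Amon _] := Amax; have cN0 : c != 0 by rewrite gt_eqF.
pose G u : set 'rV[R]_n := [set w | A u (c^-1 *: (w + z))].
have GP u v : A u v -> G u (c *: v - z).
  by move=> Auv; rewrite /G /= subrK scalerA mulVf// scale1r.
have Gmon : monotone_op G.
  move=> u u' w w' Gw Gw'; have := Amon _ _ _ _ Gw Gw'.
  rewrite -scalerBr opprD addrACA subrr addr0 dotpZr pmulr_rge0 ?invr_gt0//.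
have [x xG] := debrunner_flor Gmon (GP _ _ Auv0).
exists x; apply: maximal_monotone_mem => u v Auv.
have := xG _ _ (GP _ _ Auv).
have -> : c *: v - z + x = - c *: (c^-1 *: (z - x) - v).
  by rewrite scaleNr scalerBr scalerA mulfV// scale1r !opprB addrA [RHS]addrAC.
rewrite -(opprB x) dotpNl dotpZr mulNr opprK pmulr_rge0//.
Qed.

Variable a : R.
Hypotheses (a_gt0 : 0 < a) (Astrong : strongly_monotone a A).

(** Strong monotonicity makes the set of pairs (u, v / a - u) monotone;
    Debrunner-Flor then yields an x with <u - x, v> >= a |u - x|^2 on the graph
    of A, and maximality puts (x, 0) in that graph. *)
Lemma strongly_monotone_zero u0 v0 : A u0 v0 -> exists x, A x 0.
Proof.
move=> Auv0; have aN0 : a != 0 by rewrite gt_eqF.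
pose G u : set 'rV[R]_n := [set w | A u (a *: (w + u))].
have GP u v : A u v -> G u (a^-1 *: v - u).
  by move=> Auv; rewrite /G /= subrK scalerA mulfV// scale1r.
have Gmon : monotone_op G.
  move=> u u' w w' Gw Gw'; have := Astrong Gw Gw'.
  rewrite -scalerBr opprD addrACA dotpZr enorm_sqr ler_pM2l// [leRHS]dotpDr.
  lra.
have [x xG] := debrunner_flor Gmon (GP _ _ Auv0).
exists x; apply: maximal_monotone_mem => u v Auv.
have := xG _ _ (GP _ _ Auv).
have -> : a^-1 *: v - u + x = a^-1 *: v - (u - x) by rewrite opprB addrA addrAC.
rewrite dotpDr dotpNr dotpZr subr_ge0 => /(le_trans (dotp_ge0 _)).
by rewrite pmulr_rge0 ?invr_gt0// -(opprB x) sub0r dotpNl dotpNr.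
Qed.

Lemma strongly_monotone_inj x x' y : A x y -> A x' y -> x = x'.
Proof.
move=> Ax Ax'; apply/eqP; rewrite -subr_eq0; apply/eqP/dotp_eq0/eqP.
rewrite eq_le dotp_ge0 andbT -(ler_pM2l a_gt0) mulr0.
by have := Astrong Ax Ax'; rewrite subrr dotp0 enorm_sqr.
Qed.

Lemma mem_resolvent (c : R) (z x : 'rV[R]_n) : c != 0 ->
  resolvent c A z x <-> A x (c^-1 *: (z - x)).
Proof.
move=> cN0; split=> [[t Axt <-]|Ax]; first by rewrite addrC addKr scalerK.
by exists (c^-1 *: (z - x)) => //; rewrite scalerA mulfV// scale1r addrC subrK.
Qed.

Lemma resolvent_strongly_monotone (c : R) (z z' x x' : 'rV[R]_n) : 0 < c ->
  resolvent c A z x -> resolvent c A z' x' ->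
  (1 + c * a) * dotp (x - x') (x - x') <= dotp (x - x') (z - z').
Proof.
move=> c0; have cN0 : c != 0 by rewrite gt_eqF.
move=> /(mem_resolvent _ _ cN0) Ax /(mem_resolvent _ _ cN0) Ax'.
have := Astrong Ax Ax'.
rewrite -scalerBr enorm_sqr dotpZr ler_pdivlMl// mulrA.
have -> : z - x - (z' - x') = (z - z') - (x - x').
  by apply/rowP => i; rewrite !mxE; ring.
move: (x - x') (z - z') => d e; rewrite dotpDr dotpNr; lra.
Qed.

Lemma resolvent_zero (c : R) x : A x 0 -> resolvent c A x x.
Proof. by exists 0 => //; rewrite scaler0 addr0. Qed.

Lemma resolvent_single_valued (c : R) u0 v0 : 0 < c -> A u0 v0 ->
  exists F, forall z, resolvent c A z = [set F z].
Proof.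
move=> c0 Auv0; have cN0 : c != 0 by rewrite gt_eqF.
have /choice[F FP] : forall z, exists x, resolvent c A z x.
  by move=> z; have [x /(mem_resolvent _ _ cN0)] := minty z c0 Auv0; exists x.
exists F => z; apply/seteqP; split=> [x Rx|_ ->]; last exact: FP.
apply/eqP; rewrite -subr_eq0; apply/eqP/dotp_eq0/eqP.
have := resolvent_strongly_monotone c0 Rx (FP z).
rewrite subrr dotp0 pmulr_rle0 ?addr_gt0 ?mulr_gt0// => le0.
by rewrite eq_le le0 dotp_ge0.
Qed.

Variable C : set 'rV[R]_n.
Hypothesis domA : op_dom A = C.

(** A normal vector at x pairs nonnegatively with x - z for every z in
    C = D(A), so adding it to an element of A x keeps the pair monotonically
    related to the graph of A. *)
Lemma vi_op_dom : vi_op A C = A.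
Proof.
have dom x y : A x y -> C x by rewrite -domA => ?; exists y.
apply/funext => x; apply/seteqP; rewrite /vi_op; case: ifPn => [|/negP xC].
  rewrite inE => Cx; split=> [_ [u Axu [v Nv <-]]|y Axy] /=.
    apply: maximal_monotone_mem => x' y' Ax'; have [Amon _] := Amax.
    rewrite addrAC dotpDr addr_ge0 ?Amon// dotpC Nv//; exact: dom Ax'.
  by exists y => //; exists 0; [move=> z _; rewrite dotpC dotp0|rewrite addr0].
by split=> // y /dom Cx; apply: xC; rewrite inE.
Qed.

(** If y in A x satisfies the variational inequality then, for v in A u,
    <u - x, v> = <u - x, v - y> + <u - x, y> >= 0, and maximality gives 0 in
    A x. *)
Lemma vi_solutionE x : vi_solution A C x <-> A x 0.
Proof.
have dom u v : A u v -> C u by rewrite -domA => ?; exists v.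
split=> [[Cx [y Axy ysol]]|Ax].
  apply: maximal_monotone_mem => u v Auv; have [Amon _] := Amax.
  have := Amon _ _ _ _ Axy Auv; have := ysol u (dom _ _ Auv).
  rewrite -(opprB x) sub0r !dotpE (dotpC y u) (dotpC y x); lra.
by split; [exact: dom Ax|exists 0 => // z _; rewrite dotpC dotp0].
Qed.

End MaximalMonotone.

(** * Block contractions and asynchronous iterations *)

Section Blocks.
Set Implicit Arguments.
Unset Strict Implicit.
Context {R : realType} {alpha : nat} {n_ : 'I_alpha -> nat}.
Implicit Types (x y z f : 'rV[R]_(\sum_i n_ i)) (r k b : R).

Lemma dotp_blocks x y :
  dotp x y = \sum_i dotp (submxrow x i) (submxrow y i).
Proof.
rewrite dotp_mulmx -[x]submxrowK -[y]submxrowK tr_mxrow mul_mxrow_mxcol summxE.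
by apply: eq_bigr => i _; rewrite !mxrowK dotp_mulmx.
Qed.

Lemma submxrowZ (c : R) x i : submxrow (c *: x) i = c *: submxrow x i.
Proof. by apply/rowP => j; rewrite !mxE. Qed.

Lemma enorm_block_le x i : enorm (submxrow x i) <= enorm x.
Proof.
rewrite ler_wsqrtr// dotp_blocks (bigD1 i)//= lerDl.
by apply: sumr_ge0 => j _; exact: dotp_ge0.
Qed.

Lemma enorm_le_blocks x r : 0 <= r ->
  (forall i, enorm (submxrow x i) <= r) -> enorm x <= Num.sqrt alpha%:R * r.
Proof.
move=> r0 xr.
rewrite -(ler_pXn2r (ltn0Sn 1)) ?nnegrE ?mulr_ge0 ?enorm_ge0 ?sqrtr_ge0//.
rewrite enorm_sqr dotp_blocks exprMn sqr_sqrtr// mulr_natl.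
rewrite -[X in _ *+ X]card_ord -sumr_const; apply: ler_sum => i _.
by rewrite -enorm_sqr ler_pXn2r// nnegrE enorm_ge0.
Qed.

(** The hypothesis says that f lies in the ball with diameter [0, y / b].  A
    block of f is thus within |y| / (2 b) of the same block of y / (2 b), and
    |y| <= sqrt alpha * r. *)
Lemma block_contraction b r f y : 0 < b -> 0 <= r ->
  b * dotp f f <= dotp f y -> (forall i, enorm (submxrow y i) <= r) ->
  forall i, enorm (submxrow f i) <= (1 + Num.sqrt alpha%:R) / (2 * b) * r.
Proof.
move=> b0 r0 fy yr i; set q := (2 * b)^-1.
have q0 : 0 < q by rewrite invr_gt0 mulr_gt0.
have qb : 2 * q * b = 1 by rewrite /q; field; rewrite gt_eqF.
have ball : enorm (f - q *: y) <= q * enorm y.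
  rewrite -(ler_pXn2r (ltn0Sn 1)) ?nnegrE ?mulr_ge0 ?enorm_ge0 ?(ltW q0)//.
  rewrite exprMn !enorm_sqr !dotpE (dotpC y f).
  have := ler_wpM2l (ltW q0) fy.
  have -> : q * (b * dotp f f) = 2^-1 * (2 * q * b) * dotp f f by field.
  rewrite qb; lra.
have -> : submxrow f i = submxrow (f - q *: y) i + q *: submxrow y i.
  by rewrite submxrowB submxrowZ subrK.
apply: (le_trans (enormD _ _)); rewrite enormZ ?(ltW q0)//.
have h1 := le_trans (enorm_block_le (f - q *: y) i) ball.
have h2 := ler_wpM2l (ltW q0) (enorm_le_blocks r0 yr).
have h3 := ler_wpM2l (ltW q0) (yr i).
lra.
Qed.

(** Both bounds on b matter: the first is an equality for the least admissible
    c when alpha > 1, the second is what remains when alpha = 1. *)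
Lemma contraction_factor_lt1 b : Num.sqrt alpha%:R <= b -> 1 < b ->
  (1 + Num.sqrt alpha%:R) / (2 * b) < 1 :> R.
Proof. by move=> ab b1; rewrite ltr_pdivrMr; lra. Qed.

(** Boxes of radius k^m M around xstar in the maximum of the block norms are
    entered one after the other and never left: d steps after an entry all reads
    come from the current box, and the next synchronous step then moves every
    block into the following one. *)
Lemma async_cvg k (F : 'rV[R]_(\sum_i n_ i) -> 'rV[R]_(\sum_i n_ i)) xstar :
  0 <= k -> k < 1 ->
  (forall r z, 0 <= r -> (forall i, enorm (submxrow (z - xstar) i) <= r) ->
    forall i, enorm (submxrow (F z - xstar) i) <= k * r) ->
  forall x0 J s (x : nat -> 'rV[R]_(\sum_i n_ i)),
  async_algorithm F x0 J s x -> x @ \oo --> xstar.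
Proof.
move=> k0 k1 Fk x0 J s x [_ [d delay] [pk pkmono sync] [_ xS]].
pose e p i := enorm (submxrow (x p - xstar) i).
have e_idle p i : ~ J p i -> e p.+1 i = e p i.
  by move=> nJ; rewrite /e !submxrowB (xS p i).1.
have e_active r p i : 0 <= r -> J p i -> (forall j, e (s p j) j <= r) ->
    e p.+1 i <= k * r.
  move=> r0 Jpi le; rewrite /e submxrowB (xS p i).2// -submxrowB.
  by apply: Fk => // j; rewrite submxrowB mxrowK -submxrowB; exact: le.
pose M := \sum_i e 0%N i.
have M0 : 0 <= M by apply: sumr_ge0 => i _; exact: enorm_ge0.
have stage m : exists P, forall p, (P <= p)%N -> forall i, e p i <= k ^+ m * M.
  elim: m => [|m [P eP]].
    exists 0%N => p _; rewrite expr0 mul1r.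
    elim/ltn_ind: p => -[_ i|p IH i].
      rewrite /M (bigD1 i)//= lerDl; apply: sumr_ge0 => j _; exact: enorm_ge0.
    have [Jpi|/e_idle->] := pselect (J p i); last exact: IH.
    apply: (@le_trans _ _ (k * M)); last by rewrite ler_piMl// ltW.
    apply: e_active => // j; apply: IH; rewrite ltnS.
    by have /andP[] := delay p j.
  have km0 : 0 <= k ^+ m * M by rewrite mulr_ge0// exprn_ge0.
  have pk_ge l : (l <= pk l)%N.
    by elim: l => // l IH; apply: (leq_ltn_trans IH); exact: pkmono.
  exists (pk (P + d)%N).+1; elim=> // p IH; rewrite ltnS leq_eqVlt => le i.
  rewrite exprS -mulrA.
  have Pdp : (P + d <= p)%N.
    by case/predU1P: le => [<-//|/ltnW]; exact: leq_trans.
  have [Jpi|nJ] := pselect (J p i).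
    apply: e_active => // j; apply: eP.
    by have /andP[] := delay p j; lia.
  move: le nJ => /predU1P[<- nJ|lt /e_idle->]; last by rewrite mulrA -exprS IH.
  by case: nJ; exact: (sync _ i).1.
apply/cvgrPdist_le => eps eps0.
have : (fun m => k ^+ m * M * Num.sqrt alpha%:R) @ \oo --> (0 : R).
  have -> : (0 : R) = 0 * M * Num.sqrt alpha%:R by rewrite !mul0r.
  apply: cvgM; last exact: cvg_cst.
  apply: cvgM; last exact: cvg_cst.
  by apply: cvg_expr; rewrite ger0_norm.
move=> /cvgrPdist_le/(_ _ eps0)[m _ /(_ m (leqnn m))] /=.
rewrite sub0r normrN => /(le_trans (ler_norm _)) small.
have [P eP] := stage m; exists P => // p /= Pp.
rewrite distrC; apply: (le_trans (norm_le_enorm _)); apply: le_trans small.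
rewrite [leRHS]mulrC; apply: enorm_le_blocks; last exact: eP.
by rewrite mulr_ge0// exprn_ge0.
Qed.

End Blocks.

(** * The variational inequality *)

Theorem corollary4p12 (R : realType) (alpha : nat) (halpha : (1 <= alpha)%N)
    (n_ : 'I_alpha -> nat) (a : R) (ha : 0 < a)
    (C : set 'rV[R]_(\sum_i n_ i)) (hC0 : C !=set0) (hCcl : closed C)
    (hCcv : convex_set C)
    (A : 'rV[R]_(\sum_i n_ i) -> set 'rV[R]_(\sum_i n_ i))
    (hA : maximal_strongly_monotone a A) (hD : op_dom A = C) :
  (exists! xstar, vi_solution A C xstar) /\
  (forall c : R, 0 < c -> (Num.sqrt alpha%:R - 1) / a <= c ->
    exists F : 'rV[R]_(\sum_i n_ i) -> 'rV[R]_(\sum_i n_ i),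
      (forall x, resolvent c (vi_op A C) x = [set F x]) /\
      (forall x0 J s x, async_algorithm F x0 J s x ->
         forall xstar, vi_solution A C xstar -> x @ \oo --> xstar)).
Proof.
have [Amax Astrong] := hA; have [u0 Cu0] := hC0.
have [v0 Auv0] : op_dom A u0 by rewrite hD.
have [xs Axs] := strongly_monotone_zero Amax ha Astrong Auv0.
split.
  exists xs; split=> [|x /(vi_solutionE Amax hD)]; first exact/vi_solutionE.
  by move=> Ax; apply: (strongly_monotone_inj ha Astrong Axs Ax).
move=> c c0 cge; have [F FP] := resolvent_single_valued Amax ha Astrong c0 Auv0.
rewrite (vi_op_dom Amax hD).
exists F; split=> // x0 J s x xasync xstar /(vi_solutionE Amax hD) Axstar.
pose b : R := 1 + c * a.
have b1 : 1 < b by rewrite ltrDl mulr_gt0.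
have b0 : 0 < b by exact: lt_trans b1.
have bge : Num.sqrt alpha%:R <= b.
  by move: cge; rewrite ler_pdivrMr// /b; lra.
have k1 := contraction_factor_lt1 bge b1.
apply: (async_cvg _ k1 _ xasync) => [|r z r0 zr i].
  by rewrite divr_ge0 ?addr_ge0 ?sqrtr_ge0 ?mulr_ge0// ltW.
apply: (block_contraction b0 r0 _ zr).
apply: (resolvent_strongly_monotone Astrong c0).
  by rewrite FP.
exact: resolvent_zero.
Qed.
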